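(* Let $\varphi:[a,b]\to[a,b]$ where $[a,b]\subset\mathbb{R}$, let $I$ be a convex subset of $\mathbb{R}$, and let $f:I\to\mathbb{R}^{+}$ be a $\log$-$\varphi$-convex function. For $a,b\in I$ with $a<b$ and $\lambda\in[0,1]$, one has the inequality $$\frac{1}{\varphi(b)-\varphi(a)}\int_{\varphi(a)}^{\varphi(b)}G\bigl(f(x),f(\varphi(a)+\varphi(b)-x)\bigr)\,dx\le G\bigl(f(\varphi(a)),f(\varphi(b))\bigr),$$ where $G(\cdot,\cdot)$ is the geometric mean.
   Context: A function $f:I\to\mathbb{R}^{+}$ is $\log$-$\varphi$-convex if $f(t\varphi(x)+(1-t)\varphi(y))\le[f(\varphi(x))]^{t}[f(\varphi(y))]^{1-t}$ for all $x,y\in I$ and $t\in[0,1]$. The geometric mean is $G(u,v)=\sqrt{uv}$. *)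

(* Defs.v *)
From HB Require Import structures.
From mathcomp Require Import all_boot all_order all_algebra.
From mathcomp Require Import all_classical all_reals all_analysis.

Set Implicit Arguments.
Unset Strict Implicit.
Unset Printing Implicit Defensive.

Import Order.TTheory GRing.Theory Num.Theory.
Import numFieldNormedType.Exports.

Local Open Scope classical_set_scope.
Local Open Scope ring_scope.

Definition geometric_mean (R : realType) (u v : R) : R := Num.sqrt (u * v).

(* [phi] is a partial function with domain [D], encoded as a total one: "all
   x, y in I" is read as all x, y in I at which [phi] is defined, so that the
   values of [phi] outside [D] are irrelevant. *)
Definition log_phi_convex (R : realType) (D : set R) (phi : R -> R)
    (I : set R) (f : R -> R) : Prop :=
  forall x y t : R, I x -> D x -> I y -> D y -> 0 <= t <= 1 ->
    f (t * phi x + (1 - t) * phi y) <= f (phi x) `^ t * f (phi y) `^ (1 - t).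

(* The oriented integral of [g] from [u] to [v], for the Lebesgue measure;
   [u <= v] is not assumed. For nonnegative [g] that is not measurable, the
   library's integral is the supremum over the simple functions below [g]. *)
Definition oriented_integral (R : realType) (u v : R) (g : R -> R) : R :=
  if u <= v then \int[@lebesgue_measure R]_(x in `[u, v]) g x
  else - \int[@lebesgue_measure R]_(x in `[v, u]) g x.

(* Main.v *)
Require Import Defs.
From HB Require Import structures.
From mathcomp Require Import all_boot all_order all_algebra.
From mathcomp Require Import all_classical all_reals all_analysis.
From mathcomp Require Import ring lra.

Import Order.TTheory GRing.Theory Num.Theory.
Import numFieldNormedType.Exports.

Local Open Scope classical_set_scope.
Local Open Scope ring_scope.

(** Write [x = t * phi a + (1 - t) * phi b]; the reflected point
    [phi a + phi b - x] has weights [1 - t] and [t]. Multiplying the two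
    log-convexity bounds, the exponents add up to 1, so that
    [f x * f (phi a + phi b - x) <= f (phi a) * f (phi b)]: the integrand is
    bounded by the constant on the right-hand side. *)

(* Holds without measurability because the integral of a nonnegative function
   is a supremum over the simple functions below it. *)
Lemma ge0_le_integral_nonmeasurable {d : measure_display}
    {T : measurableType d} {R : realType} (mu : {measure set T -> \bar R})
    (D : set T) (g h : T -> \bar R) :
  (forall x, D x -> 0 <= g x)%E -> (forall x, D x -> g x <= h x)%E ->
  (\int[mu]_(x in D) g x <= \int[mu]_(x in D) h x)%E.
Proof.
move=> g0 gh; have h0 x : D x -> (0 <= h x)%E.
  by move=> Dx; exact: le_trans (g0 x Dx) (gh x Dx).
rewrite !ge0_integralE//; apply: ereal_sup_le => _ [s /= sg <-].
by exists s => // x; apply: le_trans (sg x) _; exact: lee_restrict.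
Qed.

Lemma Rintegral_itv_le {R : realType} (u v c : R) (g : R -> R) : u <= v ->
  (forall x, u <= x <= v -> 0 <= g x <= c) ->
  \int[@lebesgue_measure R]_(x in `[u, v]) g x <= c * (v - u).
Proof.
move=> uv gc.
have g0 x : `[u, v]%classic x -> (0 <= (g x)%:E)%E.
  by rewrite /= in_itv/= => /gc/andP[? _]; rewrite lee_fin.
have int_le : (\int[@lebesgue_measure R]_(x in `[u, v]) (g x)%:E
               <= (c * (v - u))%:E)%E.
  rewrite (_ : (c * (v - u))%:E
      = \int[@lebesgue_measure R]_(x in `[u, v]) cst c%:E x)%E.
    apply: ge0_le_integral_nonmeasurable => // x.
    by rewrite /= in_itv/= => /gc/andP[_ ?]; rewrite lee_fin.
  rewrite integral_cst//= lebesgue_measure_itv/= lte_fin.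
  (* If [u < v] fails, then [u = v] and both sides vanish. *)
  case: ltP => [//|vu]; rewrite (_ : v = u) ?subrr ?mulr0 ?mule0//.
  by apply/eqP; rewrite eq_le vu uv.
have int_ge0 : (0 <= \int[@lebesgue_measure R]_(x in `[u, v]) (g x)%:E)%E.
  exact: integral_ge0.
(* The real-valued integral is [fine] of the extended one, so the bound transfers once finiteness is
   known; [int_ge0] and [int_le] give it. *)
rewrite -lee_fin fineK// ge0_fin_numE//.
by rewrite (le_lt_trans int_le) ?ltry.
Qed.

Lemma segment_param {R : realFieldType} (u v x : R) : u < v -> u <= x <= v ->
  exists2 t, 0 <= t <= 1 & x = t * u + (1 - t) * v.
Proof.
move=> uv /andP[ux xv]; have d0 : 0 < v - u by rewrite subr_gt0.
exists ((v - x) / (v - u)); last by field; rewrite gt_eqF.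
rewrite divr_ge0 ?subr_ge0 ?(ltW uv)//= ler_pdivrMr// mul1r.
by rewrite lerD2l lerN2.
Qed.

(** [phi] need not be monotone, so [u] and [v] come in either order; bounding [g] along the
    parametrized segment covers both. *)
Lemma oriented_mean_le {R : realType} (u v c : R) (g : R -> R) :
  (forall t, 0 <= t <= 1 -> 0 <= g (t * u + (1 - t) * v) <= c) ->
  1 / (v - u) * oriented_integral u v g <= c.
Proof.
move=> gc; rewrite /oriented_integral mul1r; case: (ltgtP u v) => [uv|vu|uv].
- rewrite mulrC ler_pdivrMr ?subr_gt0//; apply: Rintegral_itv_le (ltW uv) _.
  by move=> x /(segment_param _ _ _ uv)[t /gc + ->].
(* The minus sign of the reversed integral cancels that of [v - u]. Reversing the segment exchanges
   [t] and [1 - t]. *)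
- rewrite mulrN -mulNr -invrN opprB mulrC ler_pdivrMr ?subr_gt0//.
  apply: Rintegral_itv_le (ltW vu) _ => x /(segment_param _ _ _ vu)[t t01 ->].
  have : 0 <= 1 - t <= 1 by lra.
  by move=> /gc; rewrite addrC opprB (addrC 1) addrNK addrC.
(* Here the factor is [1 / 0 = 0], and [0 <= c] follows from the bound at [t = 0]. *)
- rewrite uv subrr invr0 mul0r.
  have /gc/andP[] : 0 <= (0 : R) <= 1 by rewrite lexx ler01.
  exact: le_trans.
Qed.

Lemma convex_set_itvcc {R : realType} (I : set R) (a b : R) :
  convex_set (I : set R^o) -> I a -> I b -> a < b ->
  forall x, a <= x <= b -> I x.
Proof.
move=> Icvx Ia Ib ab x /(segment_param _ _ _ ab)[t /andP[t0 t1] ->].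
have := Icvx a b (Itv01 t0 t1); rewrite !inE; exact.
Qed.

Theorem theorem8 (R : realType) (a b : R) (I : set R) (phi f : R -> R)
    (lambda : R)
    (phi_ab : set_fun `[a, b] `[a, b] phi)
    (I_convex : convex_set (I : set R^o))
    (f_pos : set_fun I `]0, +oo[ f)
    (f_conv : log_phi_convex `[a, b] phi I f)
    (aI : I a) (bI : I b) (ab : a < b)
    (lambda01 : 0 <= lambda <= 1) :
  1 / (phi b - phi a) *
    oriented_integral (phi a) (phi b)
      (fun x => geometric_mean (f x) (f (phi a + phi b - x)))
  <= geometric_mean (f (phi a)) (f (phi b)).
Proof.
have phi_in x : x \in `[a, b] -> phi x \in `[a, b].
  by move=> xab; have /= := phi_ab x xab.
have a_in : a \in `[a, b] by rewrite in_itv/= lexx ltW.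
have b_in : b \in `[a, b] by rewrite in_itv/= lexx ltW.
(* The segment between [phi a] and [phi b] stays in [[a, b]], which lies in [I] by convexity. *)
have seg_pos t : 0 <= t <= 1 -> 0 < f (t * phi a + (1 - t) * phi b).
  move=> t01; suff /f_pos : I (t * phi a + (1 - t) * phi b).
    by rewrite /= in_itv/= andbT.
  have := phi_in _ a_in; have := phi_in _ b_in; rewrite !in_itv/=.
  move=> /andP[? ?] /andP[? ?]; move: (t01) => /andP[? ?].
  apply: (convex_set_itvcc _ _ _ I_convex aI bI ab); apply/andP; split; nra.
have fa0 : 0 < f (phi a).
  by have := seg_pos 1; rewrite mul1r subrr mul0r addr0 lexx ler01; exact.
have fb0 : 0 < f (phi b).
  by have := seg_pos 0; rewrite mul0r subr0 mul1r add0r lexx ler01; exact.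
apply: oriented_mean_le => t t01; rewrite sqrtr_ge0/=; apply: ler_wsqrtr.
have t'01 : 0 <= 1 - t <= 1 by lra.
have -> : phi a + phi b - (t * phi a + (1 - t) * phi b)
          = (1 - t) * phi a + (1 - (1 - t)) * phi b by ring.
have le1 := f_conv a b t aI a_in bI b_in t01.
have le2 := f_conv a b (1 - t) aI a_in bI b_in t'01.
apply: (le_trans (ler_pM (ltW (seg_pos _ t01)) (ltW (seg_pos _ t'01)) le1 le2)).
(* Powers of equal base are grouped; positivity of the bases discharges the nonzero-base condition
   of [powRD]. *)
rewrite mulrACA -!powRD ?(gt_eqF fa0) ?(gt_eqF fb0) ?implybT//.
by rewrite [t + _]addrC !subrK [1 - t + _]addrC subrK !powRr1// ltW.
Qed.
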